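(* There is a function $f(n)\in\mathcal O(n^5)$ such that in every hedonic diversity game with $n$ agents in which all agents have strict and naturally single-peaked preferences, every sequence of IS deviations satisfying solitary homogeneity that starts from the singleton partition has length at most $f(n)$ (so the dynamics converges).
   Context: A hedonic diversity game (HDG) has agent set $N=R\cup B$ partitioned into red agents $R$ and blue agents $B$, $|N|=n$. Each agent $i$ has a weak order $\succsim_i^F$ over fractions $\{p/q: p\in\{0,\dots,|R|\},q\in[n]\}$, and evaluates a coalition $C\ni i$ by $|R\cap C|/|C|$. Strict: the orders are linear. Naturally single-peaked: for each agent $i$ and fractions $x,y,z$ with $x>y>z$ or $z>y>x$, $x\succ_i^F y$ implies $y\succsim_i^F z$. The singleton partition is $\{\{i\}:i\in N\}$. An IS deviation of agent $i$ from partition $\pi$ to $\pi'$ is a move of $i$ alone from $\pi(i)$ into another coalition of $\pi$ or into a new singleton such that $\pi'(i)\succ_i\pi(i)$ and $\pi'(j)\succsim_j\pi(j)$ for all $j\in\pi'(i)\setminus\{i\}$. A coalition is homogeneous if it is contained in $R$ or in $B$; a deviation of $i$ satisfies solitary homogeneity if, whenever $\pi'(i)$ is homogeneous, $\pi'(i)=\{i\}$. *)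

(* Defs.v *)
From mathcomp Require Import all_boot all_order all_algebra.
Set Implicit Arguments. Unset Strict Implicit. Unset Printing Implicit Defensive.
Import Order.TTheory GRing.Theory Num.Theory.
Local Open Scope ring_scope.

(* Agents are 'I_n; R : {set 'I_n} is the set of red agents, blue = ~: R.
   A preference profile is pref : 'I_n -> rat -> rat -> bool,
   pref i x y  meaning  x ≿_i y  for fractions x, y. *)

Section HDG.
Variable n : nat.
Implicit Types (R C D : {set 'I_n}) (P Q : {set {set 'I_n}}).

Definition is_fraction R (x : rat) : Prop :=
  exists p q : nat, (p <= #|R|)%N /\ (0 < q <= n)%N /\ x = p%:R / q%:R.

Definition frac R C : rat := #|R :&: C|%:R / #|C|%:R.

Definition spref (pref : 'I_n -> rat -> rat -> bool) i (x y : rat) : bool :=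
  pref i x y && ~~ pref i y x.

Definition weak_orders R (pref : 'I_n -> rat -> rat -> bool) : Prop :=
  forall i, (forall x, is_fraction R x -> pref i x x) /\
    (forall x y z, is_fraction R x -> is_fraction R y -> is_fraction R z ->
        pref i x y -> pref i y z -> pref i x z) /\
    (forall x y, is_fraction R x -> is_fraction R y -> pref i x y \/ pref i y x).

Definition strict_prefs R (pref : 'I_n -> rat -> rat -> bool) : Prop :=
  weak_orders R pref /\
  forall i x y, is_fraction R x -> is_fraction R y ->
    pref i x y -> pref i y x -> x = y.

Definition nat_single_peaked R (pref : 'I_n -> rat -> rat -> bool) : Prop :=
  forall i x y z, is_fraction R x -> is_fraction R y -> is_fraction R z ->
    ((y < x) && (z < y) || (y < z) && (x < y)) ->
    spref pref i x y -> pref i y z.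

Definition singleton_partition : {set {set 'I_n}} := [set [set i] | i : 'I_n].

(* Partition resulting from agent i leaving its coalition and joining the
   coalition T of P (or forming a new singleton if T = set0). *)
Definition move P (i : 'I_n) (T : {set 'I_n}) : {set {set 'I_n}} :=
  let rest := pblock P i :\ i in
  ((P :\ pblock P i) :\ T) :|: (if rest == set0 then set0 else [set rest])
    :|: [set i |: T].

Definition IS_SH_dev R (pref : 'I_n -> rat -> rat -> bool) P (P' : {set {set 'I_n}}) : Prop :=
  exists (i : 'I_n) (T : {set 'I_n}),
    ((T \in P /\ T != pblock P i) \/ T = set0) /\
    P' = move P i T /\
    spref pref i (frac R (pblock P' i)) (frac R (pblock P i)) /\
    (forall j, j \in pblock P' i :\ i ->
        pref j (frac R (pblock P' j)) (frac R (pblock P j))) /\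
    ((pblock P' i \subset R) || (pblock P' i \subset ~: R) ->
        pblock P' i = [set i]).

(* A sequence of deviations P = P0 -> P1 -> ... -> Pk, represented by the
   list [P1; ...; Pk]; its length is k. *)
Fixpoint dev_seq R (pref : 'I_n -> rat -> rat -> bool) P (s : seq {set {set 'I_n}}) : Prop :=
  match s with
  | [::] => True
  | P' :: s' => IS_SH_dev R pref P P' /\ dev_seq R pref P' s'
  end.

End HDG.

Definition bigO_n5 (f : nat -> nat) : Prop :=
  exists c N : nat, forall n, (N <= n)%N -> (f n <= c * n ^ 5)%N.

(* Main.v *)
Require Import Defs.
From mathcomp Require Import all_boot all_order all_algebra zify.
Set Implicit Arguments. Unset Strict Implicit. Unset Printing Implicit Defensive.
Import Order.TTheory GRing.Theory Num.Theory.

(** Starting from singletons, a coalition never contains two agents of each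
    colour, and a homogeneous coalition is a single agent.  Indeed, when a coalition has one
    agent of one colour (its centre) and [o >= 2] of the other, the last growth
    to [o] or more was accepted by the centre, so by single-peakedness the centre
    vetoes any further agent of its own colour and never wants to leave.  Hence
    an agent is always alone, or a centre, or at level [k]: [k] agents of its own
    colour facing one agent of the other colour.

    Each agent gets a height function on levels which is strictly increasing in
    its preference and satisfies [height (k+1) <= height k + A], with equality
    whenever [k+1] is preferred to [k].  Weight an agent in a coalition with [k]
    agents of its colour by [2 * height level - A * (k - 1)] (up to a constant).
    Those left behind lose at most [A] each and those joined gain exactly [A]
    each, which is exactly balanced by the mover's own term in [k], so the sum
    of the weights strictly increases along every deviation.  The only other
    loser, the partner left alone when a pair splits, loses less than the mover
    gains because heights are spread out above level 1 and compressed below it.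
    As the total weight is [O(n^4)], so is the number of deviations. *)

Lemma sub_in_count (T : eqType) (a1 a2 : pred T) (s : seq T) :
  {in s, subpred a1 a2} -> count a1 s <= count a2 s.
Proof.
move=> sub; rewrite (@eq_in_count _ a1 (predI a1 a2)) ?sub_count //.
  by move=> x /andP[].
by move=> x xs /=; case: (boolP (a1 x)) => // /(sub x xs) ->.
Qed.

(** * Height functions for one linear order on levels *)

Section Height.
Variables (ge : rel nat) (c N : nat).
Let gt q l := ge q l && ~~ ge l q.
Hypothesis ge_refl : forall q, q <= c -> ge q q.
Hypothesis ge_trans : forall q l p, q <= c -> l <= c -> p <= c ->
  ge q l -> ge l p -> ge q p.
Hypothesis ge_anti : forall q l, q <= c -> l <= c -> ge q l -> ge l q -> q = l.

(* The levels [1..c] on the increasing side of the peak; level 0 stands for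
   being alone and is never among them. *)
Definition increasing_to l := (0 < l <= c) && all (fun j => gt j.+1 j) (iota 1 l.-1).
Definition below q := count (fun l => increasing_to l && gt q l) (iota 1 c).
(** With the weak relation a level that is not increasing counts itself, so its rank is positive. *)
Definition outer_rank q := count (fun l => ~~ increasing_to l && ge q l) (iota 0 c.+1).
(* Beyond the peak, a level is placed between the multiples of [N ^ 2] of the
   increasing levels around it, at multiples of [N] above height [N ^ 2] but at
   distance less than [N] below it. *)
Definition height q :=
  if increasing_to q then N ^ 2 * q
  else if below q == 0 then N ^ 2 - N + outer_rank q
  else N ^ 2 * below q + N * outer_rank q.

Let gt_trans q l p : q <= c -> l <= c -> p <= c -> gt q l -> gt l p -> gt q p.
Proof.
move=> hq hl hp /andP[ql nlq] /andP[lp npl]; rewrite /gt (ge_trans hq hl hp ql lp) /=.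
by apply: contra npl => pq; apply: ge_trans ql.
Qed.

Lemma increasing_to_le l k : 0 < l <= k -> increasing_to k -> increasing_to l.
Proof.
move=> lk /andP[kc /allP kall]; apply/andP; split; first by lia.
by apply/allP => j; rewrite mem_iota => jl; apply: kall; rewrite mem_iota; lia.
Qed.

Lemma increasing_toS k : 0 < k -> increasing_to k.+1 = increasing_to k && (k < c) && gt k.+1 k.
Proof.
case: k => // k _; rewrite /increasing_to.
have -> : iota 1 k.+2.-1 = rcons (iota 1 k) k.+1 by rewrite -cats1 -(iotaD 1 k 1) addn1.
by rewrite all_rcons -pred_Sn; apply/idP/idP; lia.
Qed.

Lemma increasing_gt l k : 0 < l < k -> increasing_to k -> gt k l.
Proof.
elim: k => [|k IHk]; first by lia.
move=> lk ik; have k0 : 0 < k by lia.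
move: (ik); rewrite increasing_toS // => /andP[/andP[ik' kc] gk].
have [->//|nlk] := eqVneq l k.
by apply: (@gt_trans _ k) => //; [lia|lia|apply: IHk => //; lia].
Qed.

Lemma increasing_gtE l k : increasing_to l -> increasing_to k -> gt k l = (l < k).
Proof.
move=> il ik; have [/andP[lc _] /andP[kc _]] := (il, ik).
case: (ltngtP l k) => [lk|kl|->]; first by rewrite increasing_gt //; lia.
  have /andP[_ /negbTE nkl] : gt l k by apply: increasing_gt il; lia.
  by rewrite /gt nkl.
by rewrite /gt andbN.
Qed.

Lemma increasing_to1 : 0 < c -> increasing_to 1.
Proof. by move=> c0; rewrite /increasing_to c0. Qed.

Lemma outer_rank_gt0 q : q <= c -> ~~ increasing_to q -> 0 < outer_rank q.
Proof.
move=> qc nq; rewrite -has_count; apply/hasP; exists q; first by rewrite mem_iota; lia.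
by rewrite nq ge_refl.
Qed.

Lemma below_homo q q' : q <= c -> q' <= c -> gt q q' -> below q' <= below q.
Proof.
move=> qc q'c qq'; apply: sub_in_count => l; rewrite mem_iota => lc /andP[-> q'l] /=.
by apply: gt_trans q'l => //; lia.
Qed.

Lemma outer_rank_homo q q' : q <= c -> q' <= c -> gt q q' -> ~~ increasing_to q ->
  outer_rank q' < outer_rank q.
Proof.
move=> qc q'c /andP[qq' nq'q] nq.
rewrite /outer_rank.
have -> : count (fun l => ~~ increasing_to l && ge q l) (iota 0 c.+1) =
  count (pred1 q) (iota 0 c.+1) + count (fun l => [&& l != q, ~~ increasing_to l & ge q l]) (iota 0 c.+1).
  rewrite -count_predUI [X in _ + X](@eq_count _ _ pred0) ?count_pred0 ?addn0.
    by apply: eq_count => l /=; case: eqVneq => [->|//]; rewrite nq ge_refl.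
  by move=> l /=; case: eqVneq.
rewrite count_uniq_mem ?iota_uniq // mem_iota leq0n ltnS qc add1n ltnS.
apply: sub_in_count => l; rewrite mem_iota => lc /andP[-> q'l] /=.
have lc' : l <= c by lia.
by rewrite (ge_trans _ _ _ qq' q'l) // andbT; apply: contraNneq nq'q => <-.
Qed.

(** By transitivity through [k], [q] beats each of the levels 1 to [k], all of which are
    increasing. *)
Lemma below_le q k : increasing_to k -> gt q k -> q <= c -> k <= below q.
Proof.
move=> ik qk qc; have /andP[kc _] := ik.
have -> : k = count (fun l => l <= k) (iota 1 c).
  have -> : c = k + (c - k) by lia.
  rewrite iotaD count_cat (_ : count _ (iota 1 k) = k); last first.
    by rewrite -[RHS](size_iota 1); apply/eqP; rewrite -all_count; apply/allP => l; rewrite mem_iota; lia.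
  rewrite (_ : count _ _ = 0) ?addn0 //; apply/eqP; rewrite -leqn0 leqNgt -has_count.
  by apply/hasPn => l; rewrite mem_iota; lia.
apply: sub_in_count => l; rewrite mem_iota => lc lk.
rewrite (@increasing_to_le l k) //=; last by lia.
have [->//|nlk] := eqVneq l k.
by apply: gt_trans qk _; [lia|lia|lia|apply: increasing_gt => //; lia].
Qed.

Lemma below_lt q k : increasing_to k -> gt k q -> q <= c -> below q < k.
Proof.
move=> ik kq qc; have /andP[kc _] := ik.
suff : below q <= k.-1 by lia.
have -> : k.-1 = count (fun l => l < k) (iota 1 c).
  have -> : c = k.-1 + (c - k.-1) by lia.
  rewrite iotaD count_cat (_ : count _ (iota 1 k.-1) = k.-1); last first.
    by rewrite -[RHS](size_iota 1); apply/eqP; rewrite -all_count; apply/allP => l; rewrite mem_iota; lia.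
  rewrite (_ : count _ _ = 0) ?addn0 //; apply/eqP; rewrite -leqn0 leqNgt -has_count.
  by apply/hasPn => l; rewrite mem_iota; lia.
apply: sub_in_count => l; rewrite mem_iota => lc /andP[il ql].
by rewrite -increasing_gtE //; apply: gt_trans ql => //; lia.
Qed.

Hypothesis ltcN : c.+1 < N.

Let leN_sqr : N <= N ^ 2.
Proof. by rewrite -{1}[N]expn1 leq_pexp2l //; lia. Qed.

Lemma outer_rank_lt q : outer_rank q < N.
Proof. by apply: leq_ltn_trans ltcN; rewrite -[c.+1](size_iota 0) count_size. Qed.

Lemma height1 : 0 < c -> height 1 = N ^ 2.
Proof. by move=> c0; rewrite /height increasing_to1 // muln1. Qed.

(** A level that is not increasing lies strictly between [N ^ 2 * b] and [N ^ 2 * b.+1] for [b] its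
    value of [below], since its rank is positive and less than [N]. Inside such a gap the rank
    decides. *)
Lemma height_lt q q' : 0 < c -> q <= c -> q' <= c -> gt q q' -> height q' < height q.
Proof.
move=> c0 qc q'c qq'; have := outer_rank_lt q'; rewrite /height.
case: (boolP (increasing_to q')) => iq'; case: (boolP (increasing_to q)) => iq.
- have qq := qq'; rewrite (increasing_gtE iq' iq) in qq => _.
  by rewrite ltn_pmul2l // expn_gt0; lia.
- have := below_le iq' qq' qc; have := outer_rank_gt0 qc iq.
  have /andP[? _] := iq'; case: eqP; first by lia.
  move=> _ r0 bl; have := @leq_mul (N ^ 2) _ _ _ (leqnn _) bl; have : 0 < N * outer_rank q by rewrite muln_gt0; lia.
  by lia.
- have bl := below_lt iq qq' q'c; move=> r.
  have := @leq_mul (N ^ 2) _ _ _ (leqnn _) bl; rewrite mulnS => h.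
  case: eqP => [b0|_].
    have := leN_sqr.
    by rewrite b0 muln0 in h; lia.
  have : N * outer_rank q' < N ^ 2 by rewrite expnS expn1 ltn_pmul2l //; lia.
  by lia.
- have := below_homo qc q'c qq'; have := outer_rank_homo qc q'c qq' iq.
  move=> r b r'; have NN : N <= N ^ 2 by exact: leN_sqr.
  have hr : N * outer_rank q' < N * outer_rank q by rewrite ltn_pmul2l //; lia.
  have hb := @leq_mul (N ^ 2) _ _ _ (leqnn _) b.
  case: eqP => b'0; case: eqP => b0; try lia.
  (* Only [below q'] vanishes here, so [N ^ 2] separates the two heights. *)
  have : N ^ 2 * 1 <= N ^ 2 * below q by rewrite leq_mul2l; lia.
  by lia.
Qed.

Lemma heightS k : 0 < k -> increasing_to k.+1 -> height k.+1 = height k + N ^ 2.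
Proof.
move=> k0 ik; rewrite /height ik (@increasing_to_le k k.+1) ?k0 //=.
by rewrite mulnS addnC.
Qed.

(** If [k] is weakly preferred to [k.+1], antisymmetry makes this strict and the height even
    drops. *)
Lemma heightS_le k : 0 < k < c -> ge k k.+1 || increasing_to k.+1 ->
  height k.+1 <= height k + N ^ 2.
Proof.
move=> kc; case/boolP: (increasing_to k.+1) => [ik _|_]; first by rewrite heightS //; lia.
rewrite orbF => gk; apply: ltnW; apply: ltn_addr; apply: height_lt; try lia.
rewrite /gt gk; apply/negP => gk'.
by have := @ge_anti k k.+1 ltac:(lia) ltac:(lia) gk gk'; lia.
Qed.

(** Together with [height0_gt] this settles the splitting of a pair: the mover gains at least [N]
    above level 1, while the partner left alone loses less than [N]. *)
Lemma height_gt1 q : 0 < c -> q <= c -> gt q 1 -> N ^ 2 + N <= height q.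
Proof.
move=> c0 qc q1; rewrite /height.
case: ifP => iq.
  have := q1; rewrite (increasing_gtE (increasing_to1 c0) iq) => q2.
  have : N ^ 2 * 2 <= N ^ 2 * q by rewrite leq_mul2l; lia.
  have := leN_sqr.
  by lia.
have b := below_le (increasing_to1 c0) q1 qc; have r := outer_rank_gt0 qc (negbT iq).
rewrite ifF; last by lia.
by apply: leq_add; [rewrite -{1}[N^2]muln1 leq_mul2l b orbT|rewrite -{1}[N]muln1 leq_mul2l r orbT].
Qed.

Lemma height0_gt : N ^ 2 < height 0 + N.
Proof.
have r : 0 < outer_rank 0 by apply: outer_rank_gt0.
rewrite /height /=; have := leN_sqr.
case: eqP => b; first by lia.
have : N ^ 2 * 1 <= N ^ 2 * below 0 by rewrite leq_mul2l; lia.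
by lia.
Qed.

Lemma height_le q : 0 < c -> q <= c -> height q <= N ^ 3.
Proof.
move=> c0 qc; rewrite /height.
have NN : N <= N ^ 2 by exact: leN_sqr.
have N3 : N ^ 2 * c.+2 <= N ^ 3 by rewrite (expnSr N 2) leq_mul2l ltcN orbT.
have qb : N ^ 2 * q <= N ^ 2 * c by rewrite leq_mul2l qc orbT.
have r := outer_rank_lt q.
have rb : N * outer_rank q <= N ^ 2 by rewrite expnS expn1 leq_mul2l (ltnW r) orbT.
have bb : N ^ 2 * below q <= N ^ 2 * c by rewrite leq_mul2l -[X in _ <= X](size_iota 1) count_size orbT.
by case: ifP => _; last (case: ifP => _); lia.
Qed.

End Height.

(** * The partition after a move *)

Section Move.
Variables (n : nat) (P : {set {set 'I_n}}) (i : 'I_n) (T : {set 'I_n}).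
Hypothesis partP : partition P [set: 'I_n].
Hypothesis targetT : (T \in P /\ T != pblock P i) \/ T = set0.
Let C := pblock P i.

Definition new_block j :=
  if j \in i |: T then i |: T else if j \in C then C :\ i else pblock P j.

Lemma mem_block j : j \in pblock P j.
Proof. by rewrite mem_pblock (cover_partition partP) inE. Qed.

Lemma block_in j : pblock P j \in P.
Proof. by rewrite pblock_mem // (cover_partition partP) inE. Qed.

Lemma block_unique A j : A \in P -> j \in A -> pblock P j = A.
Proof. exact: def_pblock (partition_trivIset partP). Qed.

Lemma target_block j : j \in T -> pblock P j = T.
Proof. by case: targetT => [[TP _]|->]; [exact: block_unique|rewrite inE]. Qed.

Lemma target_disjoint j : j \in C -> j \notin T.
Proof.
move=> jC; apply/negP => jT; have := block_unique (block_in i) jC; rewrite (target_block jT) => TC.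
by case: targetT => [[_]|T0]; [rewrite TC eqxx|rewrite T0 inE in jT].
Qed.

Lemma in_move D : (D \in move P i T) =
  [|| [&& D != T, D != C & D \in P], (C :\ i != set0) && (D == C :\ i) | D == i |: T].
Proof.
rewrite /move -/C !inE -!orbA; congr [|| _, _ | _].
by case: eqP => [->|_]; rewrite !inE //=; case: eqP.
Qed.

Lemma mem_new_block j : j \in new_block j.
Proof.
rewrite /new_block; case: ifP => // jT; case: ifP => jC; last exact: mem_block.
by move: jT; rewrite !inE jC; case: eqP.
Qed.

Lemma new_block_in j : new_block j \in move P i T.
Proof.
rewrite in_move /new_block; case: ifP => [_|jT]; first by rewrite eqxx !orbT.
move: jT; rewrite !inE => /norP[ji jT]; case: ifP => jC.
  by rewrite eqxx andbT (_ : C :\ i != set0) ?orbT //; apply/set0Pn; exists j; rewrite !inE ji.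
rewrite block_in andbT; apply/orP; left; apply/andP; split; apply/negP => /eqP E.
  by rewrite -E mem_block in jT.
by rewrite -E mem_block in jC.
Qed.

(** A block of the new partition is determined by any of its members; disjointness of the blocks
    follows, and with it the value of [pblock]. *)
Lemma new_block_unique D j : D \in move P i T -> j \in D -> D = new_block j.
Proof.
rewrite in_move /new_block; case/or3P => [/and3P[DT DC DP] jD|/andP[_ /eqP->]|/eqP-> ->//].
  have Dj := block_unique DP jD.
  case: ifP => [|_]; last case: ifP => [jC|//].
    rewrite !inE => /orP[/eqP ji|jT]; first by rewrite /C -ji Dj eqxx in DC.
    by rewrite -Dj (target_block jT) eqxx in DT.
  by rewrite -Dj (block_unique (block_in i) jC) eqxx in DC.
rewrite !inE => /andP[/negbTE-> jC] /=.
by rewrite (negbTE (target_disjoint jC)) jC.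
Qed.

Lemma move_partition : partition (move P i T) [set: 'I_n].
Proof.
apply/and3P; split.
- apply/eqP/setP => j; rewrite inE; apply/bigcupP.
  by exists (new_block j); [exact: new_block_in|exact: mem_new_block].
- apply/trivIsetP => A B AP BP; apply: contraR => /pred0Pn[j /andP[jA jB]].
  by rewrite (new_block_unique AP jA) (new_block_unique BP jB).
- rewrite in_move !negb_or !negb_and !negbK; apply/and3P; split.
  + by rewrite (partition0 partP) !orbT.
  + by rewrite eq_sym orbN.
  + by rewrite eq_sym; apply/set0Pn; exists i; rewrite !inE eqxx.
Qed.

Lemma pblock_move j : pblock (move P i T) j = new_block j.
Proof.
by apply: def_pblock (new_block_in j) (mem_new_block j); exact: partition_trivIset move_partition.
Qed.

End Move.

(** * Colour counts and fractions relative to an agent *)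

Section Counts.
Variables (n : nat) (R : {set 'I_n}).
Implicit Types (i j : 'I_n) (C T : {set 'I_n}).

Definition same i j := (i \in R) == (j \in R).
Definition own i C := #|[set j in C | same i j]|.
Definition other i C := #|[set j in C | ~~ same i j]|.

Lemma same_sym i j : same i j = same j i.
Proof. exact: eq_sym. Qed.

Lemma same_refl i : same i i.
Proof. exact: eqxx. Qed.

Lemma own_same i j C : same i j -> own j C = own i C.
Proof. by move=> /eqP E; apply: eq_card => k; rewrite !inE /same E. Qed.

Lemma other_same i j C : same i j -> other j C = other i C.
Proof. by move=> /eqP E; apply: eq_card => k; rewrite !inE /same E. Qed.

Lemma own_diff i j C : ~~ same i j -> own j C = other i C.
Proof. by move=> E; apply: eq_card => k; rewrite !inE; move: E; rewrite /same; do 3!case: (_ \in R); case: (_ \in C). Qed.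

Lemma other_diff i j C : ~~ same i j -> other j C = own i C.
Proof. by move=> E; apply: eq_card => k; rewrite !inE; move: E; rewrite /same; do 3!case: (_ \in R); case: (_ \in C). Qed.

Lemma own_other i C : own i C + other i C = #|C|.
Proof.
by rewrite /own /other -(cardsID [set j | same i j] C); congr (_ + _); apply: eq_card => k; rewrite !inE // andbC.
Qed.

Lemma own_add i j T : i \notin T -> own j (i |: T) = same j i + own j T.
Proof.
move=> iT; rewrite /own; case: (boolP (same j i)) => ji.
  rewrite (_ : [set _ in _ | _] = i |: [set k in T | same j k]) ?cardsU1 ?inE ?(negbTE iT) //.
  by apply/setP => k; rewrite !inE; case: eqVneq => [->|].
rewrite add0n; apply: eq_card => k; rewrite !inE; case: eqVneq => // ->.
by rewrite (negbTE ji) !andbF.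
Qed.

Lemma other_add i j T : i \notin T -> other j (i |: T) = ~~ same j i + other j T.
Proof.
move=> iT; have := own_other j (i |: T); rewrite own_add // cardsU1 iT -(own_other j T).
by case: same => /=; lia.
Qed.

Lemma own_del i j C : i \in C -> own j C = same j i + own j (C :\ i).
Proof. by move=> iC; rewrite -{1}(setD1K iC) own_add // !inE eqxx. Qed.

Lemma other_del i j C : i \in C -> other j C = ~~ same j i + other j (C :\ i).
Proof. by move=> iC; rewrite -{1}(setD1K iC) other_add // !inE eqxx. Qed.

Lemma own_gt0 i C : i \in C -> 0 < own i C.
Proof. by move=> iC; rewrite (own_del _ iC) same_refl. Qed.

Lemma own_le i C : own i C <= own i setT.
Proof. by apply: subset_leq_card; apply/subsetP => j; rewrite !inE => /andP[]. Qed.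

Lemma other_le i C : other i C <= other i setT.
Proof. by apply: subset_leq_card; apply/subsetP => j; rewrite !inE => /andP[]. Qed.

Lemma own_otherT i : own i setT + other i setT = n.
Proof. by rewrite own_other cardsT card_ord. Qed.

Lemma otherP i C : reflect (exists2 j, j \in C & ~~ same i j) (0 < other i C).
Proof.
by apply: (iffP card_gt0P) => [[j]|[j jC ij]]; [rewrite inE => /andP[? ?]; exists j|exists j; rewrite inE jC].
Qed.

Lemma ownP i C : reflect (exists2 j, j \in C & same i j) (0 < own i C).
Proof.
by apply: (iffP card_gt0P) => [[j]|[j jC ij]]; [rewrite inE => /andP[? ?]; exists j|exists j; rewrite inE jC].
Qed.

Lemma homogeneous_other0 i C : i \in C -> other i C = 0 -> (C \subset R) || (C \subset ~: R).
Proof.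
move=> iC o0; have s j : j \in C -> same i j.
  by move=> jC; apply/negPn/negP => ij; have /otherP : exists2 j, j \in C & ~~ same i j; [exists j|rewrite o0].
case iR: (i \in R); apply/orP; [left|right]; apply/subsetP => j /s; rewrite /same iR ?inE; by case: (j \in R).
Qed.

(* All counts are relative to the colour of [i] ([a] agents of its colour, [b] of
   the other), so that both colours are treated at once. *)
Definition fraction i a b : rat := ((if i \in R then a else b)%:R / (a + b)%:R)%R.

Lemma fracE i C : Defs.frac R C = fraction i (own i C) (other i C).
Proof.
rewrite /Defs.frac /fraction own_other; congr (_%:R / _)%R; rewrite /own /other /same setIC.
by case: (i \in R); apply: eq_card => k; rewrite !inE; case: (k \in R).
Qed.

Definition feasible i a b := [&& 0 < a + b, a <= own i setT & b <= other i setT].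

Lemma feasible_block i C : i \in C -> feasible i (own i C) (other i C).
Proof. by move=> iC; rewrite /feasible own_le other_le own_other; apply/andP; split=> //; apply/card_gt0P; exists i. Qed.

Lemma is_fraction_feasible i a b : feasible i a b -> is_fraction R (fraction i a b).
Proof.
move=> /and3P[ab ai bi]; exists (if i \in R then a else b), (a + b); split; last split => //.
  have -> : #|R| = (if i \in R then own i setT else other i setT); last by case: ifP.
  rewrite /own /other /same; case: (i \in R); apply: eq_card => k; rewrite !inE; by case: (k \in R).
by rewrite ab -(own_otherT i) leq_add.
Qed.

Lemma fraction_lt_cross (p q p' q' : nat) : 0 < q -> 0 < q' ->
  (p%:R / q%:R < p'%:R / q'%:R :> rat)%R = (p * q' < p' * q).
Proof.
move=> q0 q'0; rewrite ltr_pdivrMr ?ltr0n // mulrAC ltr_pdivlMr ?ltr0n //.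
by rewrite -!natrM ltr_nat.
Qed.

(** Cross-multiplication, after which the common product cancels. The numerator counts red agents,
    so the order of the ratios [a : b] is reversed for blue [i]. *)
Lemma fraction_lt i a b a' b' : 0 < a + b -> 0 < a' + b' ->
  (fraction i a b < fraction i a' b')%R = if i \in R then a * b' < a' * b else a' * b < a * b'.
Proof.
move=> ab a'b'; rewrite fraction_lt_cross //; case: (i \in R); rewrite !mulnDr; lia.
Qed.

Lemma fraction_eq i a b a' b' : 0 < a + b -> 0 < a' + b' ->
  (fraction i a b == fraction i a' b') = (a * b' == a' * b).
Proof.
by move=> ab a'b'; rewrite eq_le !leNgt !fraction_lt //; case: (i \in R); lia.
Qed.

End Counts.

(** * Single-peakedness in terms of counts, and the potential *)

Section Preferences.
Variables (n : nat) (R : {set 'I_n}) (pref : 'I_n -> rat -> rat -> bool).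
Hypothesis strictP : strict_prefs R pref.
Hypothesis peakedP : nat_single_peaked R pref.
Implicit Types (i j : 'I_n) (C D T : {set 'I_n}).

Local Notation fraction := (fraction R).
Local Notation own := (own R).
Local Notation other := (other R).
Local Notation feasible := (feasible R).

Definition prefers i a b c d := spref pref i (fraction i a b) (fraction i c d).

Lemma prefers_trans i a b c d e f :
  feasible i a b -> feasible i c d -> feasible i e f ->
  prefers i a b c d -> prefers i c d e f -> prefers i a b e f.
Proof.
move=> /is_fraction_feasible fa /is_fraction_feasible fc /is_fraction_feasible fe.
case: strictP => /(_ i)[_ [tr _]] _ /andP[h1 h2] /andP[h3 h4].
rewrite /prefers /spref (tr _ _ _ fa fc fe h1 h3) /=.
by apply: contra h4 => h5; apply: tr h5 h1.
Qed.

Lemma pref_prefers i a b c d : feasible i a b -> feasible i c d -> a * d <> c * b ->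
  pref i (fraction i a b) (fraction i c d) -> prefers i a b c d.
Proof.
move=> fa fc ne h; rewrite /prefers /spref h /=; apply/negP => h'.
have /eqP := (strictP.2 _ _ _ (is_fraction_feasible fa) (is_fraction_feasible fc) h h').
by rewrite fraction_eq; [move/eqP|case/and3P: fa|case/and3P: fc].
Qed.

(** Both orientations of the ratios are allowed, so the reversal for blue agents does no harm.
    Strictness of the preferences upgrades the weak conclusion of single-peakedness. *)
Lemma prefers_peak i a b c d e f :
  feasible i a b -> feasible i c d -> feasible i e f ->
  (a * d < c * b) && (c * f < e * d) || (c * b < a * d) && (e * d < c * f) ->
  prefers i a b c d -> prefers i c d e f.
Proof.
move=> fa fc fe lt h; apply: pref_prefers => //; first by case/orP: lt => /andP[]; lia.
apply: peakedP h; try exact: is_fraction_feasible.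
case/and3P: fa => ? _ _; case/and3P: fc => ? _ _; case/and3P: fe => ? _ _.
by rewrite !fraction_lt //; move: lt; case: (i \in R); lia.
Qed.

Lemma prefers_contra i a b c d : prefers i a b c d -> ~~ pref i (fraction i c d) (fraction i a b).
Proof. by case/andP. Qed.

(** The share of own colour in [(a, b)] is at least that in [(1, o.-1)]. Having risen from
    [(1, o.-1)] to [(1, o)], the preference can only fall in the opposite direction. *)
Lemma centre_rejects i o a b : 1 < o -> feasible i 1 o -> feasible i a b ->
  prefers i 1 o 1 o.-1 -> b <= a * o.-1 -> prefers i 1 o a b.
Proof.
move=> o1 fo fa h; have f' : feasible i 1 o.-1 by move: fo; rewrite /feasible; lia.
rewrite leq_eqVlt => /orP[/eqP E|lt].
  have : fraction i a b == fraction i 1 o.-1.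
    by rewrite fraction_eq; [rewrite E; lia|case/and3P: fa|case/and3P: f'].
  by rewrite /prefers => /eqP->.
apply: (prefers_trans fo f' fa h); apply: (prefers_peak fo f' fa) h.
by lia.
Qed.

Definition level_fraction i q := if q == 0 then fraction i 1 0 else fraction i q 1.
Definition level_pref i q l := pref i (level_fraction i q) (level_fraction i l).
Definition agent_height i := height (level_pref i) (own i setT) n.+2.
(* A centre facing several agents is put at level 1. *)
Definition level i C := if other i C == 0 then 0 else own i C.
(** Subtracting [own i C] from [n] shifts each weight by a constant and keeps it a natural number
    without truncation. *)
Definition agent_potential i C :=
  2 * agent_height i (level i C) + n.+2 ^ 2 * (n - own i C).
Definition potential P := \sum_i agent_potential i (pblock P i).

Lemma own_leT i : 0 < own i setT <= n.
Proof.
by have := own_otherT R i; rewrite (own_gt0 R (in_setT i)); lia.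
Qed.

Lemma potential_le P : potential P <= 3 * n.+2 ^ 4.
Proof.
(* Per agent, the height contributes at most [2 * n.+2 ^ 3] and the second term at most
   [n.+2 ^ 3]. *)
apply: (@leq_trans (\sum_(i < n) 3 * n.+2 ^ 3)).
  apply: leq_sum => i _; rewrite /agent_potential.
  have /andP[c0 cn] := own_leT i.
  have h : agent_height i (level i (pblock P i)) <= n.+2 ^ 3.
    apply: height_le => //.
    by rewrite /level; case: ifP => // _; exact: own_le.
  have : n.+2 ^ 2 * (n - own i (pblock P i)) <= n.+2 ^ 2 * n.+2 by rewrite leq_mul2l; lia.
  by rewrite -expnSr; lia.
rewrite sum_nat_const card_ord (expnSr _ 3) mulnC mulnA leq_mul2l; lia.
Qed.

(** * Heights of one agent's levels when both colours occur *)

Section Heights.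
Variable i : 'I_n.
Hypothesis other_gt0 : 0 < other i setT.
Let c := own i setT.
Let A := n.+2 ^ 2.

Lemma feasible_level q : 0 < q <= c -> feasible i q 1.
Proof. by rewrite /feasible /c; lia. Qed.

Lemma feasible_alone : feasible i 1 0.
Proof. by have := own_leT i; rewrite /feasible; lia. Qed.

Lemma is_fraction_level q : q <= c -> is_fraction R (level_fraction i q).
Proof.
move=> qc; rewrite /level_fraction; case: eqP => [_|q0]; apply: is_fraction_feasible.
  exact: feasible_alone.
by apply: feasible_level; lia.
Qed.

Lemma level_pref_refl q : q <= c -> level_pref i q q.
Proof. by move=> qc; apply: (strictP.1 i).1; apply: is_fraction_level. Qed.

Lemma level_pref_trans q l p : q <= c -> l <= c -> p <= c ->
  level_pref i q l -> level_pref i l p -> level_pref i q p.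
Proof. by move=> qc lc pc; apply: (strictP.1 i).2.1; apply: is_fraction_level. Qed.

Lemma level_pref_anti q l : q <= c -> l <= c ->
  level_pref i q l -> level_pref i l q -> q = l.
Proof.
move=> qc lc h1 h2; have /eqP := strictP.2 _ _ _ (is_fraction_level qc) (is_fraction_level lc) h1 h2.
rewrite /level_fraction; case: (eqVneq q 0) => [->|?]; case: (eqVneq l 0) => [->|?] //.
all: by rewrite fraction_eq; lia.
Qed.

Lemma level_pref_total q l : q <= c -> l <= c -> level_pref i q l \/ level_pref i l q.
Proof. by move=> qc lc; apply: (strictP.1 i).2.2; apply: is_fraction_level. Qed.

Lemma ltcN : c.+1 < n.+2.
Proof. by have := own_leT i; rewrite /c; lia. Qed.

(** By single-peakedness a preference for [k.+1] over [k] propagates down to level 1, so one upward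
    step makes the whole run increasing. *)
Lemma increasing_level k : 0 < k < c -> spref pref i (level_fraction i k.+1) (level_fraction i k) ->
  increasing_to (level_pref i) c k.+1.
Proof.
elim: k => [|k IHk]; first by lia.
move=> kc h; rewrite increasing_toS //; apply/andP; split; last exact: h.
apply/andP; split; last by lia.
have [->|k0] := posnP k; first by apply: increasing_to1; lia.
apply: IHk; first by lia.
move: h; rewrite /level_fraction /= (gtn_eqF k0); apply: prefers_peak; try apply: feasible_level; lia.
Qed.

Lemma agent_height_lt q l : q <= c -> l <= c ->
  spref pref i (level_fraction i q) (level_fraction i l) -> agent_height i l < agent_height i q.
Proof.
apply: height_lt; [exact: level_pref_refl|exact: level_pref_trans|exact: ltcN|].
by have /andP[] := own_leT i.
Qed.

Lemma agent_heightS k : 0 < k < c ->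
  spref pref i (level_fraction i k.+1) (level_fraction i k) ->
  agent_height i k.+1 = agent_height i k + A.
Proof. by move=> kc h; apply: heightS; [lia|exact: increasing_level]. Qed.

Lemma agent_heightS_le k : 0 < k < c -> agent_height i k.+1 <= agent_height i k + A.
Proof.
move=> kc; apply: heightS_le => //.
- exact: level_pref_refl.
- exact: level_pref_trans.
- exact: level_pref_anti.
- exact: ltcN.
case/boolP: (level_pref i k k.+1) => //= nk; apply: increasing_level => //.
rewrite /spref -/(level_pref i k k.+1) nk andbT.
have [kc1 kc2] : k.+1 <= c /\ k <= c by lia.
by case: (level_pref_total kc1 kc2) => //; rewrite (negbTE nk).
Qed.

Lemma agent_height1 : agent_height i 1 = A.
Proof. by apply: height1; case/andP: (own_leT i). Qed.

Lemma agent_height_gt1 q : q <= c -> spref pref i (level_fraction i q) (level_fraction i 1) ->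
  A + n.+2 <= agent_height i q.
Proof.
apply: height_gt1; [exact: level_pref_refl|exact: level_pref_trans|exact: ltcN|].
by case/andP: (own_leT i).
Qed.

Lemma agent_height0 : A < agent_height i 0 + n.+2.
Proof. by apply: height0_gt; [exact: level_pref_refl|exact: ltcN]. Qed.

End Heights.

Lemma frac_level i C : other i C <= 1 -> (other i C = 0 -> own i C = 1) ->
  i \in C -> Defs.frac R C = level_fraction i (level i C).
Proof.
move=> o1 o0 iC; rewrite (fracE R i) /level /level_fraction.
have k0 := own_gt0 R iC.
by case: (eqVneq (other i C) 0) => [E|E]; [rewrite eqxx E o0|rewrite gtn_eqF // (_ : other i C = 1) //; lia].
Qed.

(* The second clause records that a centre accepted the last growth. *)
Definition tolerable C := forall j, j \in C ->
  (other j C = 0 -> own j C = 1) /\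
  (1 < other j C -> own j C = 1 /\ prefers j 1 (other j C) 1 (other j C).-1).

(** * A single deviation: the invariant and the potential *)

Section Step.
Variables (P : {set {set 'I_n}}) (i : 'I_n) (T : {set 'I_n}).
Hypothesis partP : partition P [set: 'I_n].
Hypothesis targetT : (T \in P /\ T != pblock P i) \/ T = set0.
Let C := pblock P i.
Let k := own i C.
Let o := other i C.
Let m := own i T.
Let o' := other i T.
Hypothesis tolP : forall D, D \in P -> tolerable D.
Hypothesis improves : spref pref i (Defs.frac R (i |: T)) (Defs.frac R C).
Hypothesis accepted : forall j, j \in T -> pref j (Defs.frac R (i |: T)) (Defs.frac R T).
Hypothesis solitary : (i |: T \subset R) || (i |: T \subset ~: R) -> i |: T = [set i].

Let iC : i \in C := mem_block partP i.
Let iT : i \notin T := target_disjoint partP targetT iC.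

Lemma tolC : tolerable C.
Proof. exact: tolP (block_in partP i). Qed.

Lemma tolT j : j \in T -> tolerable T.
Proof. by case: targetT => [[TP _] _|->]; [exact: tolP|rewrite inE]. Qed.

Let own_new : own i (i |: T) = m.+1.
Proof. by rewrite own_add // same_refl. Qed.

Let other_new : other i (i |: T) = o'.
Proof. by rewrite other_add // same_refl. Qed.

Let feasible_new : feasible i m.+1 o'.
Proof. by rewrite -own_new -other_new; apply: feasible_block; rewrite !inE eqxx. Qed.

(** Solitary homogeneity excludes a nonempty target without the other colour. If the target held two
    agents of the other colour, its centre would veto the mover. *)
Lemma target_other j : j \in T -> o' = 1.
Proof.
move=> jT; have tT := tolT jT; apply/eqP; rewrite eqn_leq andbC; apply/andP; split.
  rewrite lt0n; apply/negP => /eqP o'0.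
  have iiT : i \in i |: T by rewrite !inE eqxx.
  have := solitary (homogeneous_other0 iiT _); rewrite other_new => /(_ o'0) /setP /(_ j).
  by rewrite !inE jT orbT => /esym/eqP E; have := iT; rewrite -E jT.
rewrite leqNgt; apply/negP => o'1.
have /otherP [l lT il] : 0 < o' by exact: ltnW.
have [l0 l1] := tT _ lT; rewrite (own_diff _ il) (other_diff _ il) in l0 l1.
(* An agent [l] of the other colour has [o' > 1] agents of its own colour, itself included, which
   tolerability permits only when it faces exactly one agent. *)
have m1 : m = 1.
  case: (ltngtP m 1) => // [|mgt]; last by move: o'1; rewrite /o' (l1 mgt).1.
  by rewrite ltnS leqn0 => /eqP /l0 E; move: o'1; rewrite /o' E.
(* This [p] is the centre; the move would take it from [(1, o')] to [(2, o')], and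
   [o' <= 2 * o'.-1]. *)
have /ownP [p pT ip] : 0 < m by rewrite m1.
have [_ p1] := tT _ pT; rewrite (own_same _ ip) (other_same _ ip) in p1.
have {p1} [_ cp] := p1 o'1; have := accepted pT; rewrite !(fracE R p) !(own_same _ ip) !(other_same _ ip).
rewrite own_new other_new -/m -/o' m1; apply/negP; apply: prefers_contra.
have fpT := feasible_block R pT; rewrite (own_same _ ip) (other_same _ ip) -/m -/o' m1 in fpT.
apply: centre_rejects => //; last by move: o'1; clear; lia.
have fp : feasible p (own p (i |: T)) (other p (i |: T)).
  by apply: feasible_block; rewrite !inE pT orbT.
by move: fp; rewrite (own_same _ ip) (other_same _ ip) own_new other_new m1.
Qed.

Let other'_le1 : o' <= 1.
Proof.
by have [->//|/otherP[j /target_other-> _]] := posnP o'.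
Qed.

(** A mover facing two or more agents would be a centre. Any coalition it can join has at most one
    agent of the other colour, and [centre_rejects] ranks it lower. *)
Lemma source_other : o <= 1.
Proof.
rewrite leqNgt; apply/negP => o1; have [_ /(_ o1)[k1 ci]] := tolC iC.
have := improves; rewrite !(fracE R i) own_new other_new -/k -/o => /andP[h _].
suff /prefers_contra : prefers i k o m.+1 o' by rewrite h.
have fC := feasible_block R iC; rewrite k1 in fC.
rewrite /k k1; apply: centre_rejects => //.
by apply: leq_trans other'_le1 _; rewrite muln_gt0 /=; move: o1; clear; lia.
Qed.

Lemma source_alone : o = 0 -> k = 1.
Proof. exact: (tolC iC).1. Qed.

(** Only the agent of the other colour in [T] can come to face several agents, and its consent to
    the present move is exactly the preference to be recorded. *)
Lemma tolerable_new : tolerable (i |: T).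
Proof.
move=> j jiT; case/boolP: (same R i j) => ij.
  rewrite (own_same _ ij) (other_same _ ij) own_new other_new; split=> [o'0|]; last by rewrite ltnNge other'_le1.
  have [->//|/ownP[l lT _]] := posnP m.
  by have := target_other lT; rewrite o'0.
have jT : j \in T by move: jiT; rewrite !inE => /orP[/eqP ji|//]; rewrite ji same_refl in ij.
have o'1 := target_other jT; rewrite (own_diff _ ij) (other_diff _ ij) own_new other_new o'1; split=> // m1.
split=> //; have := accepted jT; rewrite !(fracE R j) !(own_diff _ ij) !(other_diff _ ij) own_new other_new -/m -/o' o'1.
have fj : feasible j 1 m.+1.
  by have := feasible_block R jiT; rewrite (own_diff _ ij) (other_diff _ ij) own_new other_new o'1.
by apply: pref_prefers => //; move: fj m1; rewrite /feasible; clear; lia.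
Qed.

Lemma tolerable_rest : tolerable (C :\ i).
Proof.
move=> j; rewrite !inE => /andP[ji jC].
have ownD := own_del R _ iC; have otherD := other_del R _ iC.
have o1 := source_other; have k1 := source_alone.
have jCi : j \in C :\ i by rewrite !inE ji.
case/boolP: (same R i j) => ij.
  have := ownD i; have := otherD i; rewrite same_refl -/k -/o (own_same _ ij) (other_same _ ij) => oi ki.
  have := own_gt0 R jCi; rewrite (own_same _ ij).
  by move: o1 k1 oi ki; clear; lia.
have := ownD i; have := otherD i; rewrite same_refl -/k -/o (own_diff _ ij) (other_diff _ ij) => oi ki.
have := own_gt0 R jCi; rewrite (own_diff _ ij) => oD; split.
  by move: o1 k1 oi ki oD; clear; lia.
move=> k2; split; first by move: o1 oi oD; clear; lia.
have [_] := tolC jC; rewrite (own_diff _ ij) (other_diff _ ij) -/k -/o => /(_ _)[].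
  by move: ki k2; clear; lia.
have fj := feasible_block R jC; rewrite (own_diff _ ij) (other_diff _ ij) -/k -/o in fj.
have -> : own i (C :\ i) = k.-1 by rewrite ki.
have k3 : 2 < k by rewrite ki.
have oE : o = 1 by move: o1 oi oD; clear; lia.
rewrite oE in fj.
(* The recorded preference for [(1, k)] over [(1, k.-1)] passes down to [(1, k.-1)] over
   [(1, k.-2)]. *)
move=> _; apply: prefers_peak; rewrite /feasible; move: fj k3; rewrite /feasible; clear; lia.
Qed.

Lemma move_tolerable D : D \in move P i T -> tolerable D.
Proof.
rewrite (in_move P i T) => /or3P[/and3P[_ _ /tolP//]|/andP[_ /eqP->]|/eqP->].
  exact: tolerable_rest.
exact: tolerable_new.
Qed.

(** With one colour only, the mover would start alone and end alone, which is no improvement. *)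
Lemma source_other_total : 0 < other i setT.
Proof.
have [o0|op] := posnP o; last exact: leq_trans (other_le R i C).
have [T0|/set0Pn[j /target_other o1]] := eqVneq T set0; last first.
  by apply: leq_trans (other_le R i T); rewrite -/o' o1.
case/andP: improves => _; rewrite !(fracE R i) own_new other_new -/k -/o o0 source_alone //.
have -> : m = 0 by rewrite /m T0 /own; apply: eq_card0 => l; rewrite !inE.
have -> : o' = 0 by rewrite /o' T0 /other; apply: eq_card0 => l; rewrite !inE.
move=> /negP[]; apply: (strictP.1 i).1; apply: is_fraction_feasible.
by have := own_leT i; rewrite /feasible; clear; lia.
Qed.

Lemma other_total j : 0 < other j setT.
Proof.
case/boolP: (same R i j) => ij; first by rewrite (other_same _ ij) source_other_total.
by rewrite (other_diff _ ij) (leq_trans _ (own_le R i C)) // own_gt0.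
Qed.

Lemma level_le D : level i D <= own i setT.
Proof. by rewrite /level; case: eqP => // _; exact: own_le. Qed.

Lemma mover_improves :
  spref pref i (level_fraction i (level i (i |: T))) (level_fraction i (level i C)).
Proof.
have iiT : i \in i |: T by rewrite !inE eqxx.
rewrite -!frac_level //.
- exact: source_other.
- exact: source_alone.
- by rewrite other_new.
- exact: (tolerable_new iiT).1.
Qed.

(** The extra term is nonzero only when a pair splits, and pays for the partner: the mover leaves
    level 1 and its doubled height rises by at least [2 * n.+2]. *)
Lemma mover_potential :
  2 * agent_height i (level i C) + 2 * n.+1 * (o * (k == 1)) < 2 * agent_height i (level i (i |: T)).
Proof.
have i0 := other_total i; have [l1 l2] := (level_le C, level_le (i |: T)).
have lt := agent_height_lt i0 l2 l1 mover_improves.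
case: (eqVneq k 1) => [k1|_]; last by rewrite !muln0 addn0 ltn_mul2l.
have [->|o0] := posnP o; first by rewrite muln0 addn0 ltn_mul2l.
have oE : o = 1 by move: o0 source_other; clear; lia.
have := mover_improves; rewrite {2}/level -/o oE /= -/k k1 => /(agent_height_gt1 i0 l2).
rewrite /level -/o oE /= -/k k1 (agent_height1 i).
by clear; lia.
Qed.

(** For an agent of the mover's colour the doubled height gains [2 * n.+2 ^ 2] and the second term
    gives back half of it. *)
Lemma joined_potential j : j \in T ->
  agent_potential j T + n.+2 ^ 2 * same R i j <= agent_potential j (i |: T).
Proof.
move=> jT; have o1 := target_other jT; have acc := accepted jT.
have jiT : j \in i |: T by rewrite !inE jT orbT.
have fT := feasible_block R jT; have fiT := feasible_block R jiT.
have ownj : own j (i |: T) = same R i j + own j T by rewrite own_add // same_sym.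
have otherj : other j (i |: T) = ~~ same R i j + other j T by rewrite other_add // same_sym.
rewrite !(fracE R j) ownj otherj in acc; rewrite ownj otherj in fiT.
rewrite /agent_potential /level ownj otherj.
move: acc fT fiT (own_leT j) (own_le R j (i |: T)); rewrite ownj.
case/boolP: (same R i j) => ij /=; rewrite !(add0n, add1n).
  have m0 : 0 < m by have := own_gt0 R jT; rewrite (own_same _ ij).
  rewrite (own_same T ij) (other_same T ij) -/m -/o' o1 /= => acc fT fiT cn mc.
  have mm : m.+1 * 1 <> m * 1 by clear; lia.
  have m1 : 0 < m < own j setT by rewrite m0.
  have -> : agent_height j m.+1 = agent_height j m + n.+2 ^ 2.
    apply: agent_heightS m1 _; first exact: other_total.
    by rewrite /level_fraction (gtn_eqF m0) /=; apply: pref_prefers.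
  have -> : n - m = (n - m.+1).+1 by move: mc cn; clear; lia.
  by rewrite mulnS; clear; lia.
rewrite (own_diff T ij) (other_diff T ij) -/m -/o' o1 /= => acc fT fiT cn c0.
rewrite muln0 addn0 leq_add2r leq_mul2l /=.
(* The agent of the other colour stays at level 1 unless it was alone; then its consent makes its
   height rise. *)
case: (posnP m) => [m0|_]; last exact: leqnn.
rewrite m0 /= in acc fT fiT *; apply/ltnW/agent_height_lt => //; first exact: other_total.
by rewrite /level_fraction /=; apply: pref_prefers.
Qed.

(** Agents of the mover's colour drop one level, a net loss of at most [n.+2 ^ 2]. The centre stays
    at level 1 unless it is left alone. *)
Lemma left_potential j : j \in C :\ i ->
  agent_potential j C <=
  agent_potential j (C :\ i) + (n.+2 ^ 2 * same R i j + 2 * n.+1 * (~~ same R i j && (k == 1))).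
Proof.
move=> jCi; have jC : j \in C by move: jCi; rewrite !inE => /andP[].
have o1 := source_other; have k1 := source_alone.
have ownj := own_del R j iC; have otherj := other_del R j iC; rewrite same_sym in ownj otherj.
have own0 := own_gt0 R jCi; have cn := own_leT j; have kc := own_le R j C.
have hl := @agent_heightS_le j (other_total j); have h0 := agent_height0 (other_total j).
have h1 := agent_height1 j.
rewrite /agent_potential /level ownj otherj; move: ownj otherj own0 kc.
case/boolP: (same R i j) => ij /=; rewrite !(add0n, add1n).
  rewrite (own_same C ij) (other_same C ij) -/k -/o => kE <- k0 kc.
  have oE : o = 1.
    case: (posnP o) => [/k1|]; first by rewrite kE; move: k0; clear; lia.
    by move: o1; clear; lia.
  rewrite oE /=; set q := own j (C :\ i) in kE k0 *.
  have qc : 0 < q < own j setT by move: k0 kc; rewrite kE; clear; lia.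
  have := hl q qc.
  have -> : n - q = (n - q.+1).+1 by move: kc cn; rewrite kE; clear; lia.
  by rewrite mulnS; clear; lia.
rewrite (own_diff C ij) (other_diff C ij) -/k -/o => <- kE o0 kc.
have oE : o = 1 by move: o0 o1; clear; lia.
rewrite oE kE /= h1 eqSS; case: eqP => [_|/eqP] //=.
  by move: h0; rewrite !muln1; clear; lia.
by rewrite h1; clear; lia.
Qed.

Lemma own_sum D : i \notin D -> own i D = \sum_(j | j != i) (j \in D) && same R i j.
Proof.
move=> iD; rewrite /own -sum1_card big_mkcond [RHS]big_mkcond /=.
apply: eq_bigr => j _; rewrite inE; case: eqVneq => [->|_]; first by rewrite (negbTE iD).
by case: (_ && _).
Qed.

Lemma other_sum D : i \notin D -> other i D = \sum_(j | j != i) (j \in D) && ~~ same R i j.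
Proof.
move=> iD; rewrite /other -sum1_card big_mkcond [RHS]big_mkcond /=.
apply: eq_bigr => j _; rewrite inE; case: eqVneq => [->|_]; first by rewrite (negbTE iD).
by case: (_ && _).
Qed.

Lemma others_potential :
  \sum_(j | j != i) agent_potential j (pblock P j) + n.+2 ^ 2 * m <=
  \sum_(j | j != i) agent_potential j (new_block P i T j) +
    (n.+2 ^ 2 * k.-1 + 2 * n.+1 * (o * (k == 1))).
Proof.
have iCi : i \notin C :\ i by rewrite !inE eqxx.
(* The sums run over [j != i], so all counts are rewritten for sets without [i]. *)
have -> : k.-1 = own i (C :\ i) by rewrite /k (own_del _ _ iC) same_refl.
have -> : o = other i (C :\ i) by rewrite /o (other_del _ _ iC) same_refl.
rewrite /m !own_sum // other_sum // big_distrl !big_distrr -!big_split /=.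
apply: leq_sum => j ji; rewrite /new_block -/C !inE (negbTE ji) /=.
case: ifP => jT.
  rewrite (target_block partP targetT jT) (leq_trans (joined_potential jT)) //.
  exact: leq_addr.
rewrite muln0 addn0; case: ifP => jC; last exact: leq_addr.
rewrite (block_unique partP (block_in partP i) jC) -/C.
have jCi : j \in C :\ i by rewrite !inE ji jC.
apply: leq_trans (left_potential jCi) _; rewrite leq_add2l leq_add2l leq_mul2l /=.
by case: (~~ _); case: (_ == _).
Qed.

Lemma potential_lt : potential P < potential (move P i T).
Proof.
rewrite /potential (bigD1 i) //= [X in _ < X](bigD1 i) //=.
under [X in _ < _ + X]eq_bigr do rewrite pblock_move //.
have newi : new_block P i T i = i |: T by rewrite /new_block !inE eqxx.
rewrite pblock_move // newi -/C.
have := others_potential; have := mover_potential.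
have [_ lk] := andP (own_leT i); have kc := leq_trans (own_le R i C) lk.
have := leq_trans (own_le R i (i |: T)) lk; rewrite own_new => mc.
have k0 := own_gt0 R iC.
have potC : agent_potential i C = 2 * agent_height i (level i C) + n.+2 ^ 2 * (n - k) by [].
have potT : agent_potential i (i |: T) =
  2 * agent_height i (level i (i |: T)) + n.+2 ^ 2 * (n - m.+1) by rewrite /agent_potential own_new.
rewrite potC potT.
(* Both sides equal [n.-1]: the mover's own term balances the losses of those left against the gains
   of those joined, so the gain in [mover_potential] decides. *)
have : n - k + k.-1 = n - m.+1 + m by move: kc k0 mc; rewrite -/k; clear; lia.
move/(congr1 (muln (n.+2 ^ 2))); rewrite !mulnDr; clear.
move: (n.+2 ^ 2 * (n - k)) (n.+2 ^ 2 * k.-1) (n.+2 ^ 2 * (n - m.+1)) (n.+2 ^ 2 * m).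
move: (2 * n.+1 * (o * (k == 1))) (2 * agent_height i (level i C)).
by move: (2 * agent_height i _) (\sum_(j | _) _) (\sum_(j | _) _) => *; lia.
Qed.

End Step.

(** * Sequences of deviations from the singleton partition *)

Lemma IS_SH_dev_step P P' : partition P [set: 'I_n] -> (forall D, D \in P -> tolerable D) ->
  IS_SH_dev R pref P P' ->
  [/\ partition P' [set: 'I_n], forall D, D \in P' -> tolerable D & potential P < potential P'].
Proof.
move=> partP tolP [i [T [targetT [-> [improves [accepted solitary]]]]]].
have block := pblock_move partP targetT.
have newi : pblock (move P i T) i = i |: T by rewrite block /new_block !inE eqxx.
rewrite newi in improves accepted solitary.
have acc j : j \in T -> pref j (Defs.frac R (i |: T)) (Defs.frac R T).
  move=> jT; have ji : j != i.
    by apply: contraTneq jT => ->; apply: (target_disjoint partP targetT); exact: mem_block.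
  have jiT : j \in (i |: T) :\ i by rewrite !inE ji jT orbT.
  have := accepted j jiT; rewrite block (target_block partP targetT jT) /new_block.
  by rewrite !inE jT orbT.
split.
- exact: move_partition.
- by move=> D; apply: move_tolerable.
- exact: potential_lt.
Qed.

Lemma dev_seq_size P s : partition P [set: 'I_n] -> (forall D, D \in P -> tolerable D) ->
  dev_seq R pref P s -> size s + potential P <= 3 * n.+2 ^ 4.
Proof.
elim: s P => [|P' s IHs] P partP tolP /=; first by rewrite potential_le.
case=> /(IS_SH_dev_step partP tolP)[partP' tolP' lt] /(IHs _ partP' tolP').
by apply: leq_trans; rewrite addSnnS leq_add2l.
Qed.

Lemma singleton_tolerable D : D \in singleton_partition n -> tolerable D.
Proof.
case/imsetP => i _ -> j /set1P ->.
have := own_other R i [set i]; have := own_gt0 R (set11 i); rewrite cards1.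
by move=> h1 h2; split; move: h1 h2; clear; lia.
Qed.

Lemma singleton_partitionP : partition (singleton_partition n) [set: 'I_n].
Proof.
apply/and3P; split.
- by apply/eqP/setP => j; rewrite inE; apply/bigcupP; exists [set j]; rewrite ?set11 ?imset_f.
- apply/trivIsetP => _ _ /imsetP[i _ ->] /imsetP[j _ ->] ij.
  by rewrite disjoints1 inE; apply: contraNneq ij => ->.
- by apply/imsetP => -[i _ /setP /(_ i)]; rewrite !inE eqxx.
Qed.

End Preferences.

Theorem theorem4p4 :
  exists f : nat -> nat, bigO_n5 f /\
    forall (n : nat) (R : {set 'I_n}) (pref : 'I_n -> rat -> rat -> bool),
      strict_prefs R pref -> nat_single_peaked R pref ->
      forall s : seq {set {set 'I_n}},
        dev_seq R pref (singleton_partition n) s -> (size s <= f n)%N.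
Proof.
exists (fun n => 3 * n.+2 ^ 4); split.
  (* For [n >= 1], [n.+2 <= 3 * n], and [243 = 3 * 3 ^ 4]; the bound obtained is already of order
     [n ^ 4]. *)
  exists 243, 1 => n n1; apply: (@leq_trans (3 * (3 * n) ^ 4)).
    by rewrite leq_mul2l leq_exp2r //; lia.
  by rewrite expnMn mulnA leq_mul2l leq_pexp2l.
move=> n R pref strictP peakedP s /(dev_seq_size strictP peakedP (singleton_partitionP n)).
by move/(_ (@singleton_tolerable _ _ _)); apply: leq_trans; exact: leq_addr.
Qed.
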